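(* Let $G$ be a group and $H\le G$ with inclusion $\iota_G:H\hookrightarrow G$. There exist categories $\mathsf{A}$ and $\mathsf{B}$, with $\mathsf{Grp}^{\leftrightarrow}\le\mathsf{A}\le\mathsf{Grp}$, such that the following are equivalent. (1) $H$ is characteristic in $G$. (2) There is a functor $\mathcal{C}:\mathsf{A}\to\mathsf{A}$ and a counit $\eta:\mathcal{C}\Rightarrow\mathrm{id}_{\mathsf{A}}$ such that $H=\mathrm{Im}(\eta_G)$. (3) There is an $(\mathsf{A},\mathsf{B})$-morphism $\mathcal{M}:\mathsf{B}\to\mathsf{A}$ (with respect to some $(\mathsf{A},\mathsf{B})$-bicapsule structures on $\mathsf{B}$ and on $\mathsf{A}$, where the left action of $\mathsf{A}$ on $\mathsf{A}$ and the right action of $\mathsf{B}$ on $\mathsf{B}$ are regular) such that $\iota_G=\mathcal{M}(\mathrm{id}_G\cdot\mathbb{1}_{\mathsf{B}})$.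
   Context: $\mathsf{Grp}$ is the category of groups; $\mathsf{Grp}^{\leftrightarrow}$ is the subcategory of all groups and their isomorphisms; $\mathsf{X}\le\mathsf{Y}$ means $\mathsf{X}$ is a subcategory of $\mathsf{Y}$. $H$ is characteristic in $G$ if $\varphi(H)=H$ for all $\varphi\in\mathrm{Aut}(G)$. A counit is a natural transformation $\mathcal{C}\Rightarrow\mathrm{id}_{\mathsf{A}}$. A category is identified with its collection of morphisms with partial composition $fg=f\circ g$. For a morphism $f$, let $s(f)$ and $t(f)$ be the identity morphisms of its domain and codomain; $fg$ is defined iff $s(f)=t(g)$. $\mathbb{1}_{\mathsf{A}}$ denotes the collection of identity morphisms of $\mathsf{A}$. A left action of a category $\mathsf{A}$ on a collection $X$ consists of a collection $\lhd X$, functions $a\mapsto a\lhd$ from $\mathsf{A}$ to $\lhd X$ and $x\mapsto\lhd x$ from $X$ to $\lhd X$, and a partial function $(a,x)\mapsto a\cdot x\in X$ such that: $a\cdot x$ is defined iff $a\lhd=\lhd x$; $s(a)\lhd=a\lhd$, and $s(a)\cdot x=x$ whenever defined; and if $(ab)\cdot x$ is defined then $a\cdot(b\cdot x)$ is defined and equal to it. The action is full if for every $a$ there is $x$ with $a\lhd=\lhd x$. A category $\mathsf{X}$ is a left $\mathsf{A}$-capsule if it has a full left $\mathsf{A}$-action (on morphisms) with $\lhd\mathsf{X}=\mathbb{1}_{\mathsf{X}}$, $\lhd x=t(x)$ and $a\cdot(xy)=(a\cdot x)y$. Right actions and right capsules are defined symmetrically. An $(\mathsf{A},\mathsf{B})$-bicapsule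 is a category $\mathsf{X}$ that is a left $\mathsf{A}$-capsule and a right $\mathsf{B}$-capsule with $a\cdot(x\cdot b)=(a\cdot x)\cdot b$. The left (right) regular action of a category on itself is by composition on the left (right). For a left $\mathsf{A}$-capsule $\mathsf{X}$ and a morphism $a$ of $\mathsf{A}$, there is exactly one $e\in\mathbb{1}_{\mathsf{X}}$ with $a\cdot e$ defined; $a\cdot\mathbb{1}_{\mathsf{X}}$ denotes the element $a\cdot e$. An $(\mathsf{A},\mathsf{B})$-morphism between $(\mathsf{A},\mathsf{B})$-bicapsules $\mathsf{Y}\to\mathsf{X}$ is a partial function $\mathcal{M}$ on morphisms such that, whenever $a\cdot y\cdot b$ is defined, $\mathcal{M}(a\cdot y\cdot b)$ is defined and equals $a\cdot\mathcal{M}(y)\cdot b$. It need not be a functor. *)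

(* Defs.v *)
From HB Require Import structures.
From mathcomp Require Import all_boot.
From mathcomp Require Import boolp classical_sets.

Set Implicit Arguments.
Unset Strict Implicit.
Unset Printing Implicit Defensive.

Local Open Scope classical_set_scope.

(** A category is its collection of morphisms with a partial composition:
    [src f] and [tgt f] are the identity morphisms of the domain and of the
    codomain of [f], and [comp f g] is f o g.  Partial functions are
    option-valued, so an equation between options says that one side is defined
    iff the other one is, with the same value. *)

Record category := Category {
  mor : Type;
  src : mor -> mor;
  tgt : mor -> mor;
  comp : mor -> mor -> option mor;
  src_src : forall f, src (src f) = src f;
  tgt_src : forall f, tgt (src f) = src f;
  src_tgt : forall f, src (tgt f) = tgt f;
  tgt_tgt : forall f, tgt (tgt f) = tgt f;
  comp_defined : forall f g, isSome (comp f g) <-> src f = tgt g;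
  src_comp : forall f g h, comp f g = Some h -> src h = src g;
  tgt_comp : forall f g h, comp f g = Some h -> tgt h = tgt f;
  comp_src : forall f, comp f (src f) = Some f;
  comp_tgt : forall f, comp (tgt f) f = Some f;
  compA : forall f g h,
    obind (comp f) (comp g h) = obind (fun k => comp k h) (comp f g)
}.

Lemma sval_eq (T : Type) (P : T -> Prop) (u v : {x : T | P x}) :
  sval u = sval v -> u = v.
Proof.
case: u v => [x Px] [y Py] /= xy; case: _ / xy Py => Py.
by rewrite (Prop_irrelevance Px Py).
Qed.

(** Collections of morphisms are [Prop]-valued predicates and [sig] types:
    MathComp's [set] and [subType] live in the universe of the carriers of
    [groupType], which is too small for the morphisms of [Grp]. *)

Definition ident (C : category) : Type := {e : mor C | src e = e}.

Definition srcI (C : category) (f : mor C) : ident C :=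
  exist _ (src f) (src_src f).

Definition tgtI (C : category) (f : mor C) : ident C :=
  exist _ (tgt f) (src_tgt f).

Record subcategory (C : category) := Subcategory {
  smem : mor C -> Prop;
  smem_src : forall f, smem f -> smem (src f);
  smem_tgt : forall f, smem f -> smem (tgt f);
  smem_comp : forall f g h, smem f -> smem g -> comp f g = Some h -> smem h
}.

Definition subcat_le (C : category) (S T : subcategory C) : Prop :=
  forall f, smem S f -> smem T f.

Section Subcat.
Variables (C : category) (S : subcategory C).
Local Notation smor := {f : mor C | smem S f}.

Definition subcat_src (f : smor) : smor :=
  exist _ (src (sval f)) (smem_src (svalP f)).

Definition subcat_tgt (f : smor) : smor :=
  exist _ (tgt (sval f)) (smem_tgt (svalP f)).

Definition subcat_comp (f g : smor) : option smor :=
  match comp (sval f) (sval g) as o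
    return comp (sval f) (sval g) = o -> option smor with
  | Some h => fun e => Some (exist _ h (smem_comp (svalP f) (svalP g) e))
  | None => fun=> None
  end erefl.

Lemma subcat_compE f g : omap sval (subcat_comp f g) = comp (sval f) (sval g).
Proof.
rewrite /subcat_comp.
by move: (@smem_comp C S (sval f) (sval g)); case: (comp _ _).
Qed.

Lemma subcat_comp_some f g h :
  subcat_comp f g = Some h <-> comp (sval f) (sval g) = Some (sval h).
Proof.
rewrite -subcat_compE; case: (subcat_comp f g) => [k|] //=.
by split=> [[->]|[/sval_eq ->]].
Qed.

Lemma subcat_comp_defined f g :
  isSome (subcat_comp f g) <-> subcat_src f = subcat_tgt g.
Proof.
have -> : isSome (subcat_comp f g) = isSome (comp (sval f) (sval g)).
  by rewrite -subcat_compE; case: (subcat_comp f g).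
split=> [/comp_defined e|/(congr1 sval) e]; first exact: sval_eq.
exact/comp_defined.
Qed.

Lemma subcat_compA f g h :
  obind (subcat_comp f) (subcat_comp g h) =
  obind (fun k => subcat_comp k h) (subcat_comp f g).
Proof.
have inj (x y : option smor) : omap sval x = omap sval y -> x = y.
  by case: x y => [x|] [y|] //= [/sval_eq ->].
apply: inj; have := compA (sval f) (sval g) (sval h).
rewrite -!subcat_compE.
by case: (subcat_comp g h) => [x|]; case: (subcat_comp f g) => [y|] /=;
  rewrite -?subcat_compE.
Qed.

Definition subcat : category.
Proof.
refine (@Category smor subcat_src subcat_tgt subcat_comp
  _ _ _ _ subcat_comp_defined _ _ _ _ subcat_compA).
- by move=> f; apply: sval_eq; apply: src_src.
- by move=> f; apply: sval_eq; apply: tgt_src.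
- by move=> f; apply: sval_eq; apply: src_tgt.
- by move=> f; apply: sval_eq; apply: tgt_tgt.
- by move=> f g h /subcat_comp_some e; apply: sval_eq; apply: src_comp e.
- by move=> f g h /subcat_comp_some e; apply: sval_eq; apply: tgt_comp e.
- by move=> f; apply/subcat_comp_some; apply: comp_src.
- by move=> f; apply/subcat_comp_some; apply: comp_tgt.
Defined.

End Subcat.

Record functor (C D : category) := Functor {
  fmor : mor C -> mor D;
  fmor_src : forall f, fmor (src f) = src (fmor f);
  fmor_tgt : forall f, fmor (tgt f) = tgt (fmor f);
  fmor_comp : forall f g h,
    comp f g = Some h -> comp (fmor f) (fmor g) = Some (fmor h)
}.

Definition id_functor (C : category) : functor C C :=
  @Functor C C id (fun=> erefl) (fun=> erefl) (fun _ _ _ e => e).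

Record nat_trans (C D : category) (F F' : functor C D) := NatTrans {
  ntc : ident C -> mor D;
  src_ntc : forall e, src (ntc e) = fmor F (sval e);
  tgt_ntc : forall e, tgt (ntc e) = fmor F' (sval e);
  ntc_natural : forall f : mor C,
    comp (ntc (tgtI f)) (fmor F f) = comp (fmor F' f) (ntc (srcI f))
}.

Definition counit (A : category) (F : functor A A) : Type :=
  nat_trans F (id_functor A).

(** [lact a x] is a . x, defined iff [lanch a = lpos x]; the collection <|X is
    the type [Q]. *)

Record left_action (A : category) (X Q : Type) := LeftAction {
  lanch : mor A -> Q;
  lpos : X -> Q;
  lact : mor A -> X -> option X;
  lact_defined : forall a x, isSome (lact a x) <-> lanch a = lpos x;
  lanch_src : forall a, lanch (src a) = lanch a;
  lact_src : forall a x, isSome (lact (src a) x) -> lact (src a) x = Some x;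
  lact_comp : forall a b c x y, comp a b = Some c -> lact c x = Some y ->
    obind (lact a) (lact b x) = Some y
}.

Record right_action (B : category) (X Q : Type) := RightAction {
  ranch : mor B -> Q;
  rpos : X -> Q;
  ract : X -> mor B -> option X;
  ract_defined : forall x b, isSome (ract x b) <-> rpos x = ranch b;
  ranch_tgt : forall b, ranch (tgt b) = ranch b;
  ract_tgt : forall x b, isSome (ract x (tgt b)) -> ract x (tgt b) = Some x;
  ract_comp : forall x a b c y, comp a b = Some c -> ract x c = Some y ->
    obind (fun z => ract z b) (ract x a) = Some y
}.

(** In a capsule <|X = 1_X, so the actions below take [Q := ident X]. *)

Definition left_capsule (A X : category)
    (L : left_action A (mor X) (ident X)) : Prop :=
  [/\ forall a, exists x, lanch L a = lpos L x,
      forall x, lpos L x = tgtI x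
    & forall a x y,
        obind (lact L a) (comp x y) = obind (fun z => comp z y) (lact L a x)].

Definition right_capsule (B X : category)
    (R : right_action B (mor X) (ident X)) : Prop :=
  [/\ forall b, exists x, rpos R x = ranch R b,
      forall x, rpos R x = srcI x
    & forall x y b,
        obind (fun z => ract R z b) (comp x y) = obind (comp x) (ract R y b)].

Definition bicapsule (A B X : category)
    (L : left_action A (mor X) (ident X))
    (R : right_action B (mor X) (ident X)) : Prop :=
  [/\ left_capsule L, right_capsule R
    & forall a x b, obind (lact L a) (ract R x b) =
                    obind (fun z => ract R z b) (lact L a x)].

Lemma comp_definedI (A : category) (a x : mor A) :
  isSome (comp a x) <-> srcI a = tgtI x.
Proof.
split=> [/comp_defined e|/(congr1 sval) e]; first exact: sval_eq.
exact/comp_defined.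
Qed.

Definition left_regular (A : category) : left_action A (mor A) (ident A).
Proof.
refine (@LeftAction A (mor A) (ident A) (@srcI A) (@tgtI A) (@comp A)
  (@comp_definedI A) _ _ _).
- by move=> a; apply: sval_eq; apply: src_src.
- by move=> a x /comp_defined; rewrite src_src => ->; apply: comp_tgt.
- by move=> a b c x y ab cx; rewrite compA ab.
Defined.

Definition right_regular (B : category) : right_action B (mor B) (ident B).
Proof.
refine (@RightAction B (mor B) (ident B) (@tgtI B) (@srcI B) (@comp B)
  (@comp_definedI B) _ _ _).
- by move=> a; apply: sval_eq; apply: tgt_tgt.
- by move=> x b /comp_defined; rewrite tgt_tgt => <-; apply: comp_src.
- by move=> x a b c y ab xc; rewrite -compA ab.
Defined.

(** a . 1_X, namely a . e for the only identity [e] at which it is defined: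
    by [left_capsule_unit] this is the anchor of [a]. *)

Definition act_unit (A X : category) (L : left_action A (mor X) (ident X))
    (a : mor A) : option (mor X) :=
  lact L a (sval (lanch L a)).

Lemma left_capsule_unit (A X : category)
    (L : left_action A (mor X) (ident X)) (a : mor A) (e : ident X) :
  left_capsule L -> isSome (lact L a (sval e)) <-> e = lanch L a.
Proof.
case=> _ posE _; rewrite lact_defined posE.
have -> : tgtI (sval e) = e.
  by apply: sval_eq => /=; rewrite -[sval e](svalP e) tgt_src (svalP e).
by split=> ->.
Qed.

Definition biact (A B X : category) (L : left_action A (mor X) (ident X))
    (R : right_action B (mor X) (ident X)) (a : mor A) (x : mor X) (b : mor B) :
    option (mor X) :=
  obind (fun z => ract R z b) (lact L a x).

Definition bicapsule_morphism (A B Y X : category)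
    (LY : left_action A (mor Y) (ident Y))
    (RY : right_action B (mor Y) (ident Y))
    (LX : left_action A (mor X) (ident X))
    (RX : right_action B (mor X) (ident X))
    (M : mor Y -> option (mor X)) : Prop :=
  forall a y b z, biact LY RY a y b = Some z ->
    isSome (M z) /\ M z = obind (fun m => biact LX RX a m b) (M y).

Record ghom := GHom {
  gdom : groupType;
  gcod : groupType;
  gfun : {multiplicative gdom -> gcod}
}.

Definition gid (G : groupType) : ghom :=
  @GHom G G (idfun : {multiplicative G -> G}).

Definition gcomp_eq (f g : ghom) (e : gcod g = gdom f) : ghom :=
  let g' : {multiplicative gdom g -> gdom f} :=
    eq_rect _ (fun K : groupType => {multiplicative gdom g -> K}) (gfun g) _ e in
  GHom (gfun f \o g' : {multiplicative gdom g -> gcod f}).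

Definition gcomp (f g : ghom) : option ghom :=
  if pselect (gcod g = gdom f) is left e then Some (gcomp_eq e) else None.

Lemma gcompE (K L N : groupType) (f : {multiplicative L -> N})
    (g : {multiplicative K -> L}) :
  gcomp (GHom f) (GHom g) = Some (GHom (f \o g : {multiplicative K -> N})).
Proof.
rewrite /gcomp; case: pselect => //= e.
by rewrite (Prop_irrelevance e erefl).
Qed.

Lemma gid_inj (G K : groupType) : gid G = gid K -> G = K.
Proof. by move=> /(congr1 gdom). Qed.

Lemma gcomp_defined f g : isSome (gcomp f g) <-> gid (gdom f) = gid (gcod g).
Proof.
rewrite /gcomp; case: pselect => [e|ne] /=; first by rewrite e.
by split=> // /gid_inj e; case: ne.
Qed.

Lemma mult_ext (K L : groupType) (f g : {multiplicative K -> L}) :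
  f =1 g -> f = g.
Proof.
case: f g => [f [[fM]]] [g [[gM]]] /= /funext fg.
by case: _ / fg gM => gM; rewrite (Prop_irrelevance fM gM).
Qed.

Definition Grp : category.
Proof.
refine (@Category ghom (fun f => gid (gdom f)) (fun f => gid (gcod f)) gcomp
  _ _ _ _ gcomp_defined _ _ _ _ _) => //.
- move=> [K L f] [K' L' g] h; rewrite /gcomp; case: pselect => //= e.
  by case=> <-.
- move=> [K L f] [K' L' g] h; rewrite /gcomp; case: pselect => //= e.
  by case=> <-.
- by move=> [K L f] /=; rewrite gcompE; congr (Some (GHom _)); apply: mult_ext.
- by move=> [K L f] /=; rewrite gcompE; congr (Some (GHom _)); apply: mult_ext.
- move=> [M N f] [L M' g] [K L' h].
  have [eL|neL] := pselect (L' = L); last first.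
    have -> : gcomp (GHom g) (GHom h) = None.
      by rewrite /gcomp; case: pselect.
    rewrite /gcomp; case: pselect => //= e; by case: pselect.
  case: _ / eL g => g.
  have [eM|neM] := pselect (M' = M); last first.
    have -> : gcomp (GHom f) (GHom g) = None.
      by rewrite /gcomp; case: pselect.
    rewrite gcompE /= /gcomp; by case: pselect.
  case: _ / eM f => f.
  rewrite !gcompE /= !gcompE.
  by congr (Some (GHom _)); apply: mult_ext.
Defined.

Definition Grp_iso : subcategory Grp.
Proof.
refine (@Subcategory Grp (fun f : ghom => bijective (gfun f)) _ _ _).
- by move=> f _ /=; exists id.
- by move=> f _ /=; exists id.
- move=> [K L f] [K' L' g] h; rewrite /= /gcomp; case: pselect => //= e.
  case: _ / e f => f fb gb [<-] /=; exact: bij_comp.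
Defined.

Lemma Grp_iso_gid (G : groupType) : smem Grp_iso (gid G).
Proof. by exists id. Qed.

Definition gid_in (A : subcategory Grp) (hA : subcat_le Grp_iso A)
    (G : groupType) : mor (subcat A) :=
  exist _ (gid G) (hA _ (Grp_iso_gid G)).

Section Subgroup.
Variables (G : groupType) (H : groupClosed G).

Record subgroup := Subgroup { sgval : G; sgvalP : sgval \in H }.

HB.instance Definition _ := [isSub for sgval].
HB.instance Definition _ := [Choice of subgroup by <:].

Lemma mem_group_closed : group_closed (fun x => x \in H).
Proof. by split=> [|x y]; [exact: gpred1 | exact: gpredF]. Qed.

HB.instance Definition _ :=
  SubChoice_isSubGroup.Build G (fun x => x \in H) subgroup mem_group_closed.

Definition incl : mor Grp :=
  @GHom subgroup G (val : {multiplicative subgroup -> G}).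

(* [gcod f] is only propositionally equal to [G], whence the [h] *)
Definition is_image (f : mor Grp) : Prop :=
  exists (K : groupType) (h : {multiplicative K -> G}),
    f = GHom h /\ range h = [set` H].

Definition characteristic : Prop :=
  forall phi : {multiplicative G -> G}, bijective phi ->
    phi @` [set` H] = [set` H].

End Subgroup.

(* Main.v *)
(** Let [core X] be the subgroup of those [x : X] that every isomorphism
    [X -> G] sends into [H] (so [core X = X] unless [X] is isomorphic to [G]).
    It is preserved by isomorphisms, and [core G = H] as soon as [H] is
    characteristic.  On the category [A] of the homomorphisms that preserve
    [core] hereditarily, [core] is a functor and its inclusion a counit.  With
    [B = A] acting on the right of [A] through this functor,
    [M b = b o eta_(s b) = eta_(t b) o core b] is a bicapsule morphism.
    Conversely, naturality of a counit, or biequivariance of [M], yields for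
    each automorphism [phi] of [G] some [q] with [phi o i = i o q], where [i]
    has image [H]; hence [phi H] is contained in [H], for all [phi]. *)

From HB Require Import structures.
From mathcomp Require Import all_boot.
From mathcomp Require Import boolp classical_sets.
Require Import Defs.

Set Implicit Arguments.
Unset Strict Implicit.
Unset Printing Implicit Defensive.

Local Open Scope group_scope.

(** * Elementary facts on group homomorphisms *)

Lemma mult1 (X Y : groupType) (f : {multiplicative X -> Y}) : f 1 = 1.
Proof. by apply: (mulgI (f 1)); rewrite -gmulfM !mulg1. Qed.

Lemma multV (X Y : groupType) (f : {multiplicative X -> Y}) :
  {morph f : x / x^-1}.
Proof. by move=> x; apply: (mulgI (f x)); rewrite -gmulfM !mulgV mult1. Qed.

Lemma mult_bij_inv (X Y : groupType) (f : {multiplicative X -> Y}) :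
  bijective f ->
  exists2 g : {multiplicative Y -> X}, cancel f g & cancel g f.
Proof.
case=> g fK gK; pose gM := isMultiplicative.Axioms_ _ _ (can2_gmulfM fK gK).
by exists (Multiplicative.Pack (Multiplicative.Class gM)).
Qed.

(** * The core of a group, its functor and its counit *)

Section Core.
Variables (G : groupType) (H : groupClosed G).

Section CorePred.
Variable X : groupType.

Definition core_pred : {pred X} :=
  fun x => `[<forall f : {multiplicative X -> G}, bijective f -> f x \in H>].

Lemma core_predP (x : X) :
  x \in core_pred <->
  forall f : {multiplicative X -> G}, bijective f -> f x \in H.
Proof. by rewrite unfold_in; split=> /asboolP. Qed.

Lemma core_pred1 : 1 \in core_pred.
Proof. by apply/core_predP => f _; rewrite mult1 gpred1. Qed.

Lemma core_predM : mulg_closed core_pred.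
Proof.
move=> x y /core_predP xC /core_predP yC; apply/core_predP => f fb.
by rewrite gmulfM gpredM ?xC ?yC.
Qed.

Lemma core_predV : invg_closed core_pred.
Proof.
move=> x /core_predP xC; apply/core_predP => f fb.
by rewrite multV gpredV xC.
Qed.

HB.instance Definition _ := isMulClosed.Build X core_pred core_predM.
HB.instance Definition _ := isMul1Closed.Build X core_pred core_pred1.
HB.instance Definition _ := isInvClosed.Build X core_pred core_predV.

Definition core_closed : groupClosed X := core_pred.
Definition core : groupType := subgroup core_closed.
Definition core_incl : {multiplicative core -> X} := val.

End CorePred.

Definition core_stable (X Y : groupType) (f : {multiplicative X -> Y}) : Prop :=
  forall x, x \in core_closed X -> f x \in core_closed Y.

Section CoreMap.
Variables (X Y : groupType) (f : {multiplicative X -> Y}) (fS : core_stable f).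

Definition core_fun (x : core X) : core Y :=
  Subgroup (H := core_closed Y) (fS (valP x)).

Lemma core_funM : {morph core_fun : x y / x * y}.
Proof. by move=> x y; apply: val_inj; rewrite /= gmulfM. Qed.

HB.instance Definition _ := isMultiplicative.Build _ _ core_fun core_funM.

Definition core_map : {multiplicative core X -> core Y} := core_fun.

End CoreMap.

(** Stability under [core] alone would not make [core] an endofunctor, as the
    restriction [core X -> core Y] has to lie in the category again. *)
CoInductive persistent (X Y : groupType) (f : {multiplicative X -> Y}) : Prop :=
  Persistent (fS : core_stable f) of persistent (core_map fS).

(** The only guarded [cofix] is made here; later proofs of persistence just exhibit an invariant
    [P], stated on bundled homomorphisms because domain and codomain change at each restriction. *)
Lemma persistent_coind (P : ghom -> Prop) :
  (forall k, P k -> exists fS : core_stable (gfun k), P (GHom (core_map fS))) ->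
  forall k, P k -> persistent (gfun k).
Proof.
by move=> PS; cofix IH => k /PS[fS Pf]; exact: Persistent (IH _ Pf).
Qed.

Lemma persistent_stable (X Y : groupType) (f : {multiplicative X -> Y}) :
  persistent f -> core_stable f.
Proof. by case. Qed.

Lemma persistent_map (X Y : groupType) (f : {multiplicative X -> Y})
  (fS : core_stable f) : persistent f -> persistent (core_map fS).
Proof. by case=> fS'; rewrite (Prop_irrelevance fS fS'). Qed.

(** An isomorphism [g : Y -> G] tests [f x] exactly as the isomorphism [g \o f : X -> G] tests
    [x]. *)
Lemma bij_core_stable (X Y : groupType) (f : {multiplicative X -> Y}) :
  bijective f -> core_stable f.
Proof.
move=> fb x /core_predP xC; apply/core_predP => g gb.
exact: (xC (g \o f : {multiplicative _ -> _})) (bij_comp gb fb).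
Qed.

(** Bijectivity is itself an invariant: the restriction of the inverse to the cores inverts the
    restriction. *)
Lemma persistent_bij k : bijective (gfun k) -> persistent (gfun k).
Proof.
apply: (persistent_coind (P := fun k => bijective (gfun k))).
case=> X Y f /= fb; exists (bij_core_stable fb).
have [g fK gK] := mult_bij_inv fb.
have gb : bijective g by exists f.
by exists (core_map (bij_core_stable gb)) => x; apply: val_inj;
  rewrite /= ?fK ?gK.
Qed.

(** The restriction of a composite is the composite of the restrictions, so being a composite of two
    persistent maps is an invariant. *)
Lemma persistent_comp (X Y Z : groupType) (f : {multiplicative Y -> Z})
    (g : {multiplicative X -> Y}) :
  persistent f -> persistent g ->
  persistent (f \o g : {multiplicative X -> Z}).
Proof.
move=> fP gP; pose P k := exists (X Y Z : groupType)
  (f : {multiplicative Y -> Z}) (g : {multiplicative X -> Y}), [/\ persistent f, persistent g &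
    k = GHom (f \o g : {multiplicative X -> Z})].
apply: (@persistent_coind P) (GHom (f \o g : {multiplicative _ -> _})) _;
  last by exists X, Y, Z, f, g.
move=> _ [{fP gP}X [{}Y [{}Z [{}f [{}g [fP gP ->]]]]]] /=.
case: (fP) (gP) => fS fP' [gS gP'].
have fgS : core_stable (f \o g : {multiplicative _ -> _}).
  by move=> x xC; apply/fS/gS.
exists fgS, (core X), (core Y), (core Z), (core_map fS), (core_map gS).
by split=> //; congr GHom; apply: mult_ext => x; apply: val_inj.
Qed.

Lemma core_incl_stable X : core_stable (core_incl X).
Proof. by move=> x _; apply: (valP x). Qed.

Lemma core_map_incl X (S : core_stable (core_incl X)) :
  core_map S = core_incl (core X).
Proof. by apply: mult_ext => x; apply: val_inj. Qed.

(** The invariant is the family of all core inclusions: restricting that of [X] gives that of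
    [core X]. *)
Lemma persistent_incl X : persistent (core_incl X).
Proof.
apply: (@persistent_coind (fun k => exists X, k = GHom (core_incl X)))
  (GHom (core_incl X)) _; last by exists X.
move=> _ [{}X ->]; exists (@core_incl_stable X), (core X).
by rewrite core_map_incl.
Qed.

Definition persistent_Grp : subcategory Grp.
Proof.
refine (@Subcategory Grp (fun f : ghom => persistent (gfun f)) _ _ _).
- by move=> f _; apply: (@persistent_bij (gid _)); exists id.
- by move=> f _; apply: (@persistent_bij (gid _)); exists id.
- move=> [Y Z f] [X Y' g] h; rewrite /= /gcomp; case: pselect => //= e.
  case: _ / e f => f fP gP [<-] /=; exact: persistent_comp.
Defined.

Lemma Grp_iso_persistent : subcat_le Grp_iso persistent_Grp.
Proof. by move=> k; apply: persistent_bij. Qed.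

Local Notation A := (subcat persistent_Grp).

Definition core_mor (k : mor A) : mor A :=
  exist (fun f : ghom => persistent (gfun f))
    (GHom (core_map (persistent_stable (svalP k))))
    (persistent_map _ (svalP k)).

Lemma core_map_id (X : groupType)
    (S : core_stable (idfun : {multiplicative X -> X})) :
  GHom (core_map S) = gid (core X).
Proof. by congr GHom; apply: mult_ext => x; apply: val_inj. Qed.

Definition core_functor : functor A A.
Proof.
refine (@Functor A A core_mor _ _ _).
- by move=> f; apply: sval_eq; rewrite /= core_map_id.
- by move=> f; apply: sval_eq; rewrite /= core_map_id.
- move=> [[Y Z f] fP] [[X Y' g] gP] [h hP].
  move=> /(@subcat_comp_some Grp persistent_Grp) /= fg.
  apply/(@subcat_comp_some Grp persistent_Grp) => /=.
  (* One copy of [fg] yields the equality of the middle groups; the other is simplified once that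
     equality is eliminated. *)
  move: fg (fg); rewrite {1}/gcomp; case: pselect => //= e _.
  case: _ / e f fP => f fP; rewrite gcompE => -[eh].
  case: _ / eh hP => hP /=; rewrite gcompE; congr (Some (GHom _)).
  by apply: mult_ext => x; apply: val_inj.
Defined.

Definition core_incl_mor (X : groupType) : mor A :=
  exist (fun f : ghom => persistent (gfun f))
    (GHom (core_incl X)) (persistent_incl X).

Definition core_counit : counit core_functor.
Proof.
refine (@NatTrans A A core_functor (id_functor A)
  (fun e => core_incl_mor (gdom (sval (sval e)))) _ _ _).
(* An identity [e] is known only through [src e = e]; rewriting it as [src e] exposes a literal
   [gid]. *)
- move=> [e eE] /=; rewrite -[in RHS]eE; apply: sval_eq.
  by rewrite /= core_map_id.
- by move=> [e eE] /=; rewrite -[in RHS]eE; apply: sval_eq.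
- move=> [[X Y f] fP].
  apply: (@inj_omap _ _ sval); first by move=> u v; apply: sval_eq.
  rewrite !subcat_compE /= !gcompE; congr (Some (GHom _)).
  exact: mult_ext.
Defined.

End Core.

(** * Equality of subgroups and of bundled homomorphisms *)

Lemma groupClosed_ext (G : groupType) (S T : groupClosed G) : S =i T -> S = T.
Proof.
case: S T => [S [[SV] [S1] [SM]]] [T [[TV] [T1] [TM]]] ST.
have {ST} : S = T by apply/funext.
move=> e; case: _ / e TV T1 TM => TV T1 TM.
by rewrite (Prop_irrelevance SV TV) (Prop_irrelevance S1 T1)
  (Prop_irrelevance SM TM).
Qed.

(** The identity is among the isomorphisms that define the core of [G], and all of them are
    automorphisms. Equality of structures, not just of members, allows [incl] of the core to be
    rewritten into [incl H]. *)
Lemma core_characteristic (G : groupType) (H : groupClosed G) :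
  characteristic H -> core_closed H G = H.
Proof.
move=> Hc; apply: groupClosed_ext => x; apply/idP/idP => [/core_predP xC|xH].
  by apply: (xC idfun); exists id.
apply/core_predP => f fb.
have : (f @` [set` H])%classic (f x) by exists x.
by rewrite (Hc f fb).
Qed.

(** Transport along explicit equalities of domain and codomain lets the bundle vary; proof
    irrelevance then makes the transport trivial. *)
Lemma GHom_inj (K L : groupType) (f g : {multiplicative K -> L}) :
  GHom f = GHom g -> f = g.
Proof.
pose cast k (eK : gdom k = K) (eL : gcod k = L) : {multiplicative K -> L} :=
  ecast Y {multiplicative K -> Y} eL
    (ecast X {multiplicative X -> gcod k} eK (gfun k)).
move=> fg; have : forall k (eK : gdom k = K) (eL : gcod k = L),
    GHom f = k -> cast k eK eL = f.
  move=> k eK eL fk; case: _ / fk eK eL => eK eL.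
  by rewrite (Prop_irrelevance eK erefl) (Prop_irrelevance eL erefl).
by move/(_ (GHom g) erefl erefl fg).
Qed.

Lemma GHom_range (K K' L : groupType) (f : {multiplicative K -> L})
    (g : {multiplicative K' -> L}) :
  GHom f = GHom g -> range f = range g.
Proof.
move=> fg; have eK : K = K' by move/(congr1 gdom): fg.
by case: _ / eK g fg => g /GHom_inj ->.
Qed.

(** * From intertwining with automorphisms to characteristic subgroups *)

Lemma intertwine_characteristic (G : groupType) (H : groupClosed G)
    (i : mor Grp) :
  is_image H i ->
  (forall phi : {multiplicative G -> G}, bijective phi ->
     exists q, comp (GHom phi : mor Grp) i = comp i q) ->
  characteristic H.
Proof.
move=> [K [h [-> hH]]] hq.
have sub (phi : {multiplicative G -> G}) x :
    bijective phi -> x \in H -> phi x \in H.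
  move=> phib xH; have [[L K' q]] := hq phi phib.
  rewrite /= gcompE /gcomp; case: pselect => //= e {hq}.
  (* Both sides are [Some] by now, so the default of [odflt] is never reached. *)
  case: _ / e h hH => h hH /(congr1 (odflt (GHom h))) /GHom_range phq.
  have [z _ hz] : range h x by rewrite hH.
  have : range (phi \o h) (phi x) by exists z => //=; rewrite hz.
  rewrite phq => -[y _ <-] /=.
  by have : range h (h (q y)) by []; rewrite hH.
move=> phi phib; apply/seteqP; split=> [_ [x xH <-]|y yH]; first exact: sub.
have [psi phiK psiK] := mult_bij_inv phib.
(* The reverse inclusion is [sub] for the inverse automorphism. *)
by exists (psi y) => //; apply: sub => //; exists phi.
Qed.

(** For an endomorphism, both components in the naturality square coincide. *)
Lemma counit_intertwine (A : category) (F : functor A A) (eta : counit F)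
    (a : mor A) :
  src a = tgt a ->
  comp a (ntc eta (srcI a)) = comp (ntc eta (srcI a)) (fmor F a).
Proof.
move=> st; have {2}-> : srcI a = tgtI a by apply: sval_eq.
by rewrite ntc_natural.
Qed.

(** With [e] the anchor of [a] and [b = a . e], the element [b] is both
    [a . e . e] and [id . e . b], so [M b] is both [a i] and [i . b]; and
    [i . b = i (id . b)] in a right capsule. *)
Lemma bicapsule_intertwine (A B : category)
    (LB : left_action A (mor B) (ident B))
    (RA : right_action B (mor A) (ident A)) (M : mor B -> option (mor A)) :
  bicapsule LB (right_regular B) -> bicapsule (left_regular A) RA ->
  bicapsule_morphism LB (right_regular B) (left_regular A) RA M ->
  forall a i, src a = tgt a -> obind M (act_unit LB (src a)) = Some i ->
  exists q, comp a i = comp i q.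
Proof.
move=> [LBc _ _] [_ [_ _ RAc] _] Mm a i st.
case: (LBc) => _ posE lactA.
set e := sval (lanch LB a).
have eE : src e = e := svalP (lanch LB a).
have te : tgt e = e by rewrite -eE tgt_src.
have ue : lact LB (src a) e = Some e.
  by apply: lact_src; apply/left_capsule_unit => //; rewrite lanch_src.
rewrite /act_unit lanch_src -/e ue /= => Me.
have : isSome (lact LB a e) by apply/left_capsule_unit.
case ab: (lact LB a e) => [b|] // _.
(* Since [tgt a] composed with [a] is [a], [tgt a] acts on [b]; so its anchor, which is that of [a],
   is [tgt b]. *)
have tb : tgt b = e.
  have := lact_comp (comp_tgt a) ab; rewrite ab /= => tab.
  have : isSome (lact LB (tgt a) b) by rewrite tab.
  by move/lact_defined; rewrite -st lanch_src posE => /(congr1 sval) /= <-.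
have be : comp b e = Some b.
  by have := lactA a e e; rewrite -{2}eE comp_src /= ab /= => {1}<-.
have [] := Mm a e e b; first by rewrite /biact ab.
rewrite Me /biact /=; case ai: (comp a i) => [c|] /=;
  last by move=> + Mb; rewrite Mb.
case Mb: (M b) => [m|] // _ /esym ce.
have [] := Mm (src a) e b b; first by rewrite /biact ue /= -tb comp_tgt.
rewrite Me /biact /= Mb; case si: (comp (src a) i) => [i'|] // _ /esym /= i'b.
have ii' : i' = i.
  have /comp_defined : isSome (comp (src a) i) by rewrite si.
  by rewrite src_src => sa; move: si; rewrite sa comp_tgt => -[].
(* The identity [e = tgt e] acts trivially on the right wherever it acts. *)
have cm : m = c.
  by have := @ract_tgt _ _ _ RA c e; rewrite te ce => /(_ isT) -[].
move: i'b; rewrite ii' cm => ib.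
have := RAc i (src i) b; rewrite comp_src /= ib.
by case: (ract RA (src i) b) => [q|] //= ->; exists q.
Qed.

(** * The bicapsule morphism of a counit *)

Section CounitBicapsule.
Variables (A : category) (F : functor A A) (eta : counit F).

Definition functor_right_action : right_action A (mor A) (ident A).
Proof.
refine (@RightAction A (mor A) (ident A) (fun b => tgtI (fmor F b)) (@srcI A)
  (fun x b => comp x (fmor F b)) _ _ _ _).
- by move=> x b; apply: comp_definedI.
- by move=> b; apply: sval_eq; rewrite /= fmor_tgt tgt_tgt.
- move=> x b; rewrite fmor_tgt => /comp_defined; rewrite tgt_tgt => <-.
  exact: comp_src.
- by move=> x a b c y /(fmor_comp F) ab xc; rewrite -compA ab.
Defined.

Definition counit_mor (b : mor A) : option (mor A) :=
  comp (ntc eta (tgtI b)) (fmor F b).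

Lemma left_regular_capsule : left_capsule (left_regular A).
Proof.
split=> //= [a|a x y]; last exact: compA.
by exists (src a); apply: sval_eq; rewrite /= tgt_src.
Qed.

Lemma regular_bicapsule : bicapsule (left_regular A) (right_regular A).
Proof.
split; first exact: left_regular_capsule.
- split=> //= [a|x y b]; last by rewrite compA.
  by exists (tgt a); apply: sval_eq; rewrite /= src_tgt.
- by move=> a x b /=; rewrite compA.
Qed.

Lemma functor_bicapsule :
  bicapsule (left_regular A) functor_right_action.
Proof.
split; first exact: left_regular_capsule.
- split=> //= [b|x y b]; last by rewrite compA.
  by exists (tgt (fmor F b)); apply: sval_eq; rewrite /= src_tgt.
- by move=> a x b /=; rewrite compA.
Qed.

(** Naturality gives the second formula, which is always defined; hence [counit_mor] is total. *)
Lemma counit_morP b : exists2 m, counit_mor b = Some m &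
  comp b (ntc eta (srcI b)) = Some m.
Proof.
rewrite /counit_mor ntc_natural /=.
have : isSome (comp b (ntc eta (srcI b))).
  by apply/comp_defined; rewrite tgt_ntc.
by case: (comp _ _) => [m|] // _; exists m.
Qed.

(** Naturality at [b] moves the counit past it: [a y b eta_(s b) = a (y eta_(s y)) F b]. *)
Lemma counit_bicapsule_morphism :
  bicapsule_morphism (left_regular A) (right_regular A) (left_regular A)
    functor_right_action counit_mor.
Proof.
move=> a y b z; rewrite /biact /=; case ay: (comp a y) => [w|] //= wb.
split; first by have [m ->] := counit_morP z.
have [n -> yn] := counit_morP y.
rewrite /= /counit_mor ntc_natural /=.
have -> : srcI z = srcI b by apply: sval_eq; apply: (src_comp wb).
have yb : tgtI b = srcI y.
  apply: sval_eq => /=; rewrite -(src_comp ay).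
  by apply/esym/comp_defined; rewrite wb.
have := compA w b (ntc eta (srcI b)); rewrite wb /= => <-.
have := ntc_natural eta b; rewrite /= yb => <-; rewrite compA.
by have := compA a y (ntc eta (srcI y)); rewrite yn ay /= => <-.
Qed.

End CounitBicapsule.

(** * The three equivalent conditions *)

Lemma is_image_incl (G : groupType) (H : groupClosed G) : is_image H (incl H).
Proof.
exists (subgroup H), val; split=> //.
apply/seteqP; split=> [_ [x _ <-]|x xH]; first exact: (valP x).
by exists (Subgroup xH).
Qed.

Theorem theorem2 (G : groupType) (H : groupClosed G) :
  exists (A : subcategory Grp) (hA : subcat_le Grp_iso A) (B : category),
    [<-> characteristic H;
         exists (F : functor (subcat A) (subcat A)) (eta : counit F),
           is_image H (sval (ntc eta (srcI (gid_in hA G))));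
         exists (LB : left_action (subcat A) (mor B) (ident B))
                (RA : right_action B (mor (subcat A)) (ident (subcat A)))
                (M : mor B -> option (mor (subcat A))),
           [/\ bicapsule LB (right_regular B),
               bicapsule (left_regular (subcat A)) RA,
               bicapsule_morphism LB (right_regular B)
                                  (left_regular (subcat A)) RA M
             & omap sval (obind M (act_unit LB (gid_in hA G)))
               = Some (incl H)]].
Proof.
pose A := persistent_Grp H; pose hA := Grp_iso_persistent H.
pose u := gid_in hA G.
pose aut (phi : {multiplicative G -> G}) (phib : bijective phi) :
  mor (subcat A) := exist _ (GHom phi : mor Grp) (hA (GHom phi) phib).
have sub_intertwine (a i : mor (subcat A)) : (exists q, comp a i = comp i q) ->
    exists q, comp (sval a) (sval i) = comp (sval i) q.
  by case=> q /(congr1 (omap sval)); rewrite !subcat_compE; exists (sval q).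
exists A, hA, (subcat A); tfae.
- move=> /core_characteristic coreG.
  exists (core_functor H), (core_counit H).
  have -> : sval (ntc (core_counit H) (srcI u)) = incl (core_closed H G) by [].
  by rewrite coreG; apply: is_image_incl.
- move=> [F [eta etaH]].
  have /core_characteristic coreG : characteristic H.
    apply: (intertwine_characteristic etaH) => phi phib.
    apply: (sub_intertwine (aut phi phib)).
    exists (fmor F (aut phi phib)).
    have <- : srcI (aut phi phib) = srcI u by apply: sval_eq; apply: sval_eq.
    by apply: counit_intertwine; apply: sval_eq.
  (* The given counit fixes only the image of its component, while the inclusion itself is wanted;
     so [core_counit] replaces it. *)
  pose eta' := core_counit H.
  exists (left_regular (subcat A)), (functor_right_action (core_functor H)),
    (counit_mor eta').
  split.
  + exact: regular_bicapsule.
  + exact: functor_bicapsule.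
  + exact: counit_bicapsule_morphism.
  + have -> : act_unit (left_regular (subcat A)) u = Some u by exact: comp_src.
    change (omap sval (counit_mor eta' u) = Some (incl H)).
    have [m ->] := counit_morP eta' u.
    (* As [u] is the identity at the target of the component, [counit_mor eta' u] is the component
       itself. *)
    have {1}<- : tgt (ntc eta' (srcI u)) = u by apply: sval_eq.
    by rewrite comp_tgt => <-; rewrite -[in RHS]coreG.
- move=> [LB [RA [M [LBc RAc Mm]]]].
  case Mu: (obind M _) => [i|] //= [iH].
  apply: (@intertwine_characteristic _ _ (incl H)).
    exact: is_image_incl.
  move=> phi phib; rewrite -iH; apply: (sub_intertwine (aut phi phib)).
  apply: (bicapsule_intertwine LBc RAc Mm); first exact: sval_eq.
  by have -> : src (aut phi phib) = u by exact: sval_eq.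
Qed.
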